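(* Let $G=3+H$ be a simple loony endgame, where $3$ denotes a 3-chain and $H$ is non-empty and composed entirely of loops (of even length at least 4). Let $f$ be the number of 4-loops in $H$ and let $c=cv(G)$. (a) If $c\ge2$ then $v(G)=c$. (b) If $c\le1$ and $v(H)=2$ then $v(G)=1$. (c) If $c\le1$, $v(H)\ne2$ and $f=0$ then $v(G)=3$. (d) If $c\le1$, $v(H)\ne2$ and $f\ge1$, let $M$ denote $G$ with all its 4-loops removed, and let $d$ be the unique integer with $0\le d\le7$ and $d\equiv v(M)\pmod 8$. If $f$ is odd then $v(G)=|4-d|$, and if $f$ is even then $v(G)=4-|4-d|$.
   Context: Game. A dots and boxes game (position) $G$ consists of a finite set of unclaimed boxes and a finite set of undrawn lines, each undrawn line bordering either exactly one box or exactly two distinct boxes, each box being bordered by at least one and at most four undrawn lines. Two players play. The player to move draws (removes) an undrawn line; every box none of whose bordering lines is still undrawn is then claimed by that player. If the move claims at least one box the same player must move again (if a line remains); otherwise the other player moves. Claiming a box when possible is not compulsory. The game ends when no line remains. Each player maximises (own boxes) minus (opponent's boxes), counting only boxes claimed from $G$ onwards. Value. $v(G)$ is the net score, under optimal play, of the player who is NOT to move in $G$. Equivalently, $v(G)=0$ if $G$ has no undrawn lines, and otherwise $v(G)=\min_m v(G;m)$ over undrawn lines $m$, where, if drawing $m$ claims $k$ boxes and leaves the position $G_m$, then $v(G;m)=v(G_m)-k$ if $k\ge1$ and $v(G;m)=-v(G_m)$ if $k=0$. Chains and loops. $G+H$ is the disjoint union. An $n$-chain (denoted $n$) has boxes $b_1,\dots,b_n$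 and lines $e_0,\dots,e_n$, where $e_i$ borders $b_i,b_{i+1}$ for $1\le i\le n-1$, $e_0$ borders only $b_1$ and $e_n$ borders only $b_n$. An $n$-loop ($n\ge4$, denoted $n_\ell$) has boxes $b_1,\dots,b_n$ and lines $e_1,\dots,e_n$, $e_i$ bordering $b_i,b_{i+1}$ (indices mod $n$). A simple loony endgame is a finite (possibly empty) disjoint union of chains of length at least 3 and loops of even length at least 4. Controlled value. If $G$ is a simple loony endgame with chains of lengths $c_i$ and loops of lengths $\ell_j$, then $fcv(G)=\sum_i(c_i-4)+\sum_j(\ell_j-8)$ and $cv(G)=fcv(G)+tb(G)$, where the terminal bonus $tb(G)$ is: $0$ if $G$ is empty; $4$ if $G$ is non-empty and has a chain of length at least 4 or has no loops; $8$ if $G$ has loops but no chains; $6$ if $G$ has both chains and loops and all its chains are 3-chains. *)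

(* Defs.v *)
From HB Require Import structures.
From mathcomp Require Import all_boot all_order all_algebra.

Set Implicit Arguments.
Unset Strict Implicit.
Unset Printing Implicit Defensive.

Import Order.TTheory GRing.Theory Num.Theory.
Local Open Scope ring_scope.

(* [box] and [line] are ambient types that do not change during play. The lines
   still undrawn are those in [undrawn]; the boxes of the position are those in
   [unclaimed] below. *)
Record position := Position {
  box : finType;
  line : finType;
  borders : line -> {set box};
  undrawn : {set line}
}.

Definition unclaimed (G : position) : {set box G} :=
  \bigcup_(m in undrawn G) borders m.

(* That every unclaimed box has at least one undrawn line is built into
   [unclaimed]. *)
Definition dots_and_boxes (G : position) : Prop :=
  (forall m, m \in undrawn G -> (1 <= #|borders m| <= 2)%N) /\
  (forall b, b \in unclaimed G ->
     (#|[set m in undrawn G | b \in borders m]| <= 4)%N).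

Definition draw (G : position) (m : line G) : position :=
  Position (@borders G) (undrawn G :\ m).

Definition claims (G : position) (m : line G) : nat :=
  #|unclaimed G :\: unclaimed (draw m)|.

(* The value on the empty sequence is the value of a position with no undrawn
   line. *)
Definition seqmin (s : seq int) : int :=
  if s is x :: s' then foldr Num.min x s' else 0.

(* [v(G;m)], given a value [w] for the position left after drawing [m]. *)
Definition move_value (G : position) (m : line G) (w : int) : int :=
  if (0 < claims m)%N then w - (claims m)%:Z else - w.

Fixpoint v_rec (n : nat) (G : position) : int :=
  if n is n'.+1
  then seqmin [seq move_value m (v_rec n' (draw m)) | m <- enum (undrawn G)]
  else 0.

(* Net score, under optimal play, of the player who is not to move. *)
Definition v (G : position) : int := v_rec #|undrawn G| G.

Lemma seqmin_mem (s : seq int) : s != [::] -> seqmin s \in s.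
Proof.
case: s => // x s _ /=; elim: s => [|y s IHs] /=; first by rewrite inE.
rewrite minEle; case: ifP => _; first by rewrite !inE eqxx orbT.
by move: IHs; rewrite !inE => /orP[-> // | ->]; rewrite !orbT.
Qed.

Lemma seqmin_le (s : seq int) x : x \in s -> seqmin s <= x.
Proof.
case: s => // y s /=; elim: s => [|z s IHs] /=.
  by rewrite inE => /eqP->.
rewrite ge_min inE => /orP[/eqP xy | ]; first by rewrite IHs ?xy ?mem_head ?orbT.
rewrite inE => /orP[/eqP-> | xs]; first by rewrite lexx.
by rewrite IHs ?orbT // inE xs orbT.
Qed.

Lemma vE (G : position) :
  v G = seqmin [seq move_value m (v (draw m)) | m <- enum (undrawn G)].
Proof.
rewrite {1}/v; case En: #|undrawn G| => [|n] /=.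
  by move/eqP: En; rewrite cards_eq0 => /eqP->; rewrite enum_set0.
congr seqmin; apply/eq_in_map => m; rewrite mem_enum => mG.
by rewrite /v (_ : #|_| = n) //= ; move: En; rewrite (cardsD1 m) mG => -[].
Qed.

Definition empty_position : position :=
  @Position void void (fun=> set0) set0.

Definition union (G H : position) : position :=
  @Position (box G + box H)%type (line G + line H)%type
    (fun m => match m with
              | inl e => inl @: borders e
              | inr e => inr @: borders e
              end)
    (inl @: undrawn G :|: inr @: undrawn H).

(* Box [j : 'I_n] is $b_{j+1}$ and line [i : 'I_n.+1] is $e_i$. *)
Definition chain (n : nat) : position :=
  @Position 'I_n 'I_n.+1
    (fun i => [set j : 'I_n | (j == i :> nat) || (j.+1 == i :> nat)]) setT.

(* [ordS i] is the cyclic successor of [i]. *)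
Definition loop (n : nat) : position :=
  @Position 'I_n 'I_n (fun i => [set i; ordS i]) setT.

(* A disjoint union of chains and loops, given by their lengths. *)
Record endgame := Endgame { chains : seq nat; loops : seq nat }.

Definition position_of (G : endgame) : position :=
  foldr union empty_position (map chain (chains G) ++ map loop (loops G)).

Definition simple_loony (G : endgame) : Prop :=
  (forall n, n \in chains G -> (3 <= n)%N) /\
  (forall n, n \in loops G -> (4 <= n)%N /\ ~~ odd n).

Definition add_endgame (G H : endgame) : endgame :=
  Endgame (chains G ++ chains H) (loops G ++ loops H).

Definition three_chain : endgame := Endgame [:: 3%N] [::].

Definition four_loops (G : endgame) : nat := count_mem 4%N (loops G).

Definition remove_four_loops (G : endgame) : endgame :=
  Endgame (chains G) [seq n <- loops G | n != 4%N].

Definition fcv (G : endgame) : int :=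
  \sum_(n <- chains G) (n%:Z - 4) + \sum_(n <- loops G) (n%:Z - 8).

Definition tb (G : endgame) : int :=
  if (chains G == [::]) && (loops G == [::]) then 0
  else if has (leq 4) (chains G) || (loops G == [::]) then 4
  else if chains G == [::] then 8
  else 6.

Definition cv (G : endgame) : int := fcv G + tb G.

Lemma dots_and_boxes_draw (G : position) (m : line G) :
  dots_and_boxes G -> dots_and_boxes (draw m).
Proof.
case=> hl hb; split=> [e | b] /=; first by rewrite inE => /andP[_ /hl].
case/bigcupP=> e /=; rewrite inE => /andP[_ eG] be.
apply: leq_trans (hb b _); last by apply/bigcupP; exists e.
by apply/subset_leq_card/subsetP=> x; rewrite !inE -andbA => /and3P[_ -> ->].
Qed.

Lemma dots_and_boxes_empty : dots_and_boxes empty_position.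
Proof. by split=> -[]. Qed.

Lemma dots_and_boxes_union (G H : position) :
  dots_and_boxes G -> dots_and_boxes H -> dots_and_boxes (union G H).
Proof.
have inlI A B : injective (@inl A B) by move=> x y [].
have inrI A B : injective (@inr A B) by move=> x y [].
case=> lG bG [lH bH]; split.
  move=> m /setUP[] /imsetP[e eu ->] /=.
    by rewrite (card_imset _ (@inlI (box G) (box H))) lG.
  by rewrite (card_imset _ (@inrI (box G) (box H))) lH.
case=> b /bigcupP[m] /setUP[] /imsetP[e eu ->] /= /imsetP[b' be // [eb]].
  have bU : b \in unclaimed G by apply/bigcupP; exists e; rewrite // eb.
  apply: leq_trans (bG b bU).
  rewrite -(card_imset _ (@inlI (line G) (line H))).
  apply/subset_leq_card/subsetP=> x; rewrite !inE => /andP[].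
  case/orP=> /imsetP[y yu ->] /= /imsetP[z zy // [ez]].
  by apply/imsetP; exists y; rewrite // inE yu ez.
have bU : b \in unclaimed H by apply/bigcupP; exists e; rewrite // eb.
apply: leq_trans (bH b bU).
rewrite -(card_imset _ (@inrI (line G) (line H))).
apply/subset_leq_card/subsetP=> x; rewrite !inE => /andP[].
case/orP=> /imsetP[y yu ->] /= /imsetP[z zy // [ez]].
by apply/imsetP; exists y; rewrite // inE yu ez.
Qed.

Lemma dots_and_boxes_chain n : (0 < n)%N -> dots_and_boxes (chain n).
Proof.
case: n => // n _; split=> [i _ | j _] /=.
  apply/andP; split.
    apply/card_gt0P; exists (inord i.-1); rewrite inE inordK.
      by case: (i : nat) => [|k] //=; rewrite eqxx orbT.
    by have := ltn_ord i; case: (i : nat).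
  apply: (@leq_trans #|[set (inord i : 'I_n.+1); inord i.-1]|); last first.
    by rewrite cards2; case: (_ != _).
  apply/subset_leq_card/subsetP=> j; rewrite !inE => /orP[] /eqP <-.
    by rewrite inord_val eqxx.
  by rewrite /= inord_val eqxx orbT.
apply: (@leq_trans #|[set (inord j : 'I_n.+2); inord j.+1]|); last first.
  by rewrite cards2; case: (_ != _).
apply/subset_leq_card/subsetP=> i; rewrite !inE /= => /orP[] /eqP ->;
  by rewrite inord_val eqxx ?orbT.
Qed.

Lemma dots_and_boxes_loop n : (1 < n)%N -> dots_and_boxes (loop n).
Proof.
move=> n1; split=> [i _ | j _] /=; first by rewrite cards2; case: (_ != _).
apply: (@leq_trans #|[set j; ord_pred j]|); last first.
  by rewrite cards2; case: (_ != _).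
apply/subset_leq_card/subsetP=> i; rewrite !inE /= => /orP[] /eqP ->.
  by rewrite eqxx.
by rewrite ordSK eqxx orbT.
Qed.

Lemma dots_and_boxes_simple_loony (G : endgame) :
  simple_loony G -> dots_and_boxes (position_of G).
Proof.
case: G => cs ls [/= hc hl]; rewrite /position_of /=.
elim: cs hc => [_ | c cs IHc hc] /=.
  elim: ls hl => [_ | l ls IHl hl] /=; first exact: dots_and_boxes_empty.
  apply: dots_and_boxes_union.
    have [l4 _] := hl l (mem_head _ _).
    by apply: dots_and_boxes_loop; apply: leq_trans l4.
  by apply: IHl => n nls; apply: hl; rewrite inE nls orbT.
apply: dots_and_boxes_union.
  by apply: dots_and_boxes_chain; apply: leq_trans (hc c (mem_head _ _)).
by apply: IHc => n ncs; apply: hc; rewrite inE ncs orbT.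
Qed.

(* Main.v *)
(* Drawing a line of a chain or loop leaves rows of lines, each with zero, one or
   two capturable end boxes; so every position that arises is a multiset of such
   rows and of loops. Opening an [n]-chain (an [n]-loop) lets the opponent
   either take everything or decline the last 2 (4) boxes, and no other reply is
   better, whence v(G) is the minimum over the components C of G of
   n - 2 + |v(G - C) - 2| for an n-chain C, resp. n - 4 + |v(G - C) - 4| for an
   n-loop C. By this recursion the value is 1-Lipschitz in the length of a loop,
   so among the loops a shortest one may be opened first. Writing A and B for
   the values of the loops alone and of the loops with the 3-chain, and adding
   the loops in decreasing order of length,
     A' = l - 4 + |A - 4|  and  B' = min (1 + |A' - 2|, l - 4 + |B - 4|).
   From (0, 3) the pair (A, B) follows (c + 3, c) as long as c >= 3; after that
   6-loops alternate between (4, 3) and (2, 1), while 4-loops fix (2, 1) and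
   otherwise alternate between A = 0 and A = 4, replacing B by 4 - B. *)

Require Import Defs.
From HB Require Import structures.
From mathcomp Require Import all_boot all_order all_algebra.
From mathcomp Require Import zify.

Set Implicit Arguments.
Unset Strict Implicit.
Unset Printing Implicit Defensive.

Import Order.TTheory GRing.Theory Num.Theory.
Local Open Scope ring_scope.

(** * Isomorphisms and disjoint unions of positions *)

Lemma seqmin_eq_mem (s t : seq int) : s =i t -> seqmin s = seqmin t.
Proof.
move=> st; have [s0 | sN] := eqVneq s [::].
  case: t st => [|x t] st; first by rewrite s0.
  by have := st x; rewrite s0 mem_head.
have tN : t != [::].
  by apply: contraNneq sN => t0; case: s st => // x s /(_ x); rewrite t0 mem_head.
by apply/le_anti/andP; split; apply: seqmin_le; [rewrite st | rewrite -st];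
  apply: seqmin_mem.
Qed.

Lemma imset_injD (A B : finType) (f : A -> B) (X Y : {set A}) :
  injective f -> f @: (X :\: Y) = f @: X :\: f @: Y.
Proof.
move=> fI; apply/setP=> b; rewrite in_setD; apply/imsetP/andP.
  by case=> a; rewrite in_setD => /andP[aY aX] ->; rewrite !mem_imset.
case=> + /imsetP[a aX bE]; rewrite bE mem_imset // => aY.
by exists a; rewrite // in_setD aY.
Qed.

(** Neither map need be surjective, and borders are compared on undrawn lines only: drawn lines and
    boxes without undrawn lines of [H] are disregarded. *)
Definition pos_iso (G H : position) : Prop :=
  exists (f : line G -> line H) (g : box G -> box H),
    [/\ injective f, injective g, f @: undrawn G = undrawn H
      & forall m, m \in undrawn G -> borders (f m) = g @: borders m].

Lemma unclaimed_iso (G H : position) (f : line G -> line H)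
    (g : box G -> box H) :
  f @: undrawn G = undrawn H ->
  (forall m, m \in undrawn G -> borders (f m) = g @: borders m) ->
  unclaimed H = g @: unclaimed G.
Proof.
move=> fu fb; apply/setP=> b; apply/bigcupP/imsetP=> [[m] | [b' /bigcupP[m mG bm] ->]].
  rewrite -fu => /imsetP[m' m'G ->]; rewrite fb // => /imsetP[b' bm ->].
  by exists b' => //; apply/bigcupP; exists m'.
by exists (f m); rewrite -?fu ?imset_f // fb // imset_f.
Qed.

Lemma v_iso (G H : position) : pos_iso G H -> v G = v H.
Proof.
case=> f [g [fI gI]].
have [n] := ubnP #|undrawn G|; elim: n G H f g fI gI => // n IHn.
move=> G H f g fI gI; rewrite ltnS => ltn fu fb.
have move_eq m : m \in undrawn G ->
    move_value m (v (draw m)) = move_value (f m) (v (draw (f m))).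
  move=> mG; have du : f @: undrawn (draw m) = undrawn (draw (f m)).
    by rewrite /= -fu imset_injD ?imset_set1.
  have db e : e \in undrawn (draw m) -> borders (f e) = g @: borders e.
    by move=> /setD1P[_ /fb].
  rewrite -(IHn (draw m) (draw (f m)) f g fI gI) //; last first.
    by move: ltn; rewrite (cardsD1 m (undrawn G)) mG.
  rewrite /move_value (_ : claims (f m) = claims m) // /claims.
  rewrite (unclaimed_iso fu fb) (@unclaimed_iso (draw m) (draw (f m)) f g) //.
  by rewrite -imset_injD ?card_imset.
rewrite (vE G) (vE H); apply: seqmin_eq_mem => x; apply/mapP/mapP=> -[m].
  rewrite mem_enum => mG ->; exists (f m); last exact: move_eq.
  by rewrite mem_enum -fu imset_f.
rewrite mem_enum -fu => /imsetP[m' mG ->] ->; exists m'; rewrite ?mem_enum //.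
by rewrite move_eq.
Qed.

Lemma inl_inj (A B : Type) : injective (@inl A B). Proof. by move=> x y []. Qed.
Lemma inr_inj (A B : Type) : injective (@inr A B). Proof. by move=> x y []. Qed.

Lemma mem_inl (A B : finType) (X : {set A}) (Y : {set B}) x :
  (inl x \in inl @: X :|: inr @: Y) = (x \in X).
Proof.
rewrite in_setU (mem_imset _ _ (@inl_inj A B)) orb_idr //.
by case/imsetP.
Qed.

Lemma mem_inr (A B : finType) (X : {set A}) (Y : {set B}) x :
  (inr x \in inl @: X :|: inr @: Y) = (x \in Y).
Proof.
rewrite in_setU (mem_imset _ _ (@inr_inj A B)) orb_idl //.
by case/imsetP.
Qed.

Lemma undrawn_inl (G H : position) m :
  (inl m \in undrawn (union G H)) = (m \in undrawn G).
Proof. exact: mem_inl. Qed.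

Lemma undrawn_inr (G H : position) m :
  (inr m \in undrawn (union G H)) = (m \in undrawn H).
Proof. exact: mem_inr. Qed.

Lemma union_iso (G G' H H' : position) :
  pos_iso G G' -> pos_iso H H' -> pos_iso (union G H) (union G' H').
Proof.
case=> f [g [fI gI fu fb]] [f' [g' [fI' gI' fu' fb']]].
exists (fun m => match m with inl e => inl (f e) | inr e => inr (f' e) end).
exists (fun m => match m with inl e => inl (g e) | inr e => inr (g' e) end).
split.
- by move=> [x|x] [y|y] // [] => [/fI|/fI'] ->.
- by move=> [x|x] [y|y] // [] => [/gI|/gI'] ->.
- rewrite /= imsetU -fu -fu' -!imset_comp.
  by congr (_ :|: _); apply: eq_imset.
move=> [m|m]; rewrite ?undrawn_inl ?undrawn_inr /= => mu.
  by rewrite fb // -!imset_comp; apply: eq_imset.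
by rewrite fb' // -!imset_comp; apply: eq_imset.
Qed.

Lemma iso_refl G : pos_iso G G.
Proof. by exists id, id; split=> // [|m _]; rewrite imset_id. Qed.

Lemma unionC_iso (G H : position) : pos_iso (union G H) (union H G).
Proof.
exists (fun m => match m with inl e => inr e | inr e => inl e end).
exists (fun m => match m with inl e => inr e | inr e => inl e end).
split; try by move=> [x|x] [y|y] // [->].
  by rewrite /= imsetU -!imset_comp setUC.
by move=> [m|m] _ /=; rewrite -imset_comp; apply: eq_imset.
Qed.

Lemma unionA_iso (G H K : position) :
  pos_iso (union G (union H K)) (union (union G H) K).
Proof.
exists (fun m => match m with inl e => inl (inl e) | inr (inl e) => inl (inr e)
  | inr (inr e) => inr e end).
exists (fun m => match m with inl e => inl (inl e) | inr (inl e) => inl (inr e)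
  | inr (inr e) => inr e end).
split; try by move=> [x|[x|x]] [y|[y|y]] // [->].
  by rewrite /= !imsetU -!imset_comp setUA.
by move=> [m|[m|m]] _ /=; rewrite -!imset_comp; apply: eq_imset.
Qed.

Lemma union0_iso (N G : position) : undrawn N = set0 -> pos_iso G (union N G).
Proof.
move=> N0; exists inr, inr; split=> //; try exact: inr_inj.
by rewrite /= N0 imset0 set0U.
Qed.

(* Phantom boxes make [pos_iso] asymmetric; equality of values in every context
   is the symmetric congruence that it generates. *)
Definition veq (G H : position) : Prop :=
  forall K, v (union K G) = v (union K H).

Lemma veq_sym G H : veq G H -> veq H G.
Proof. by move=> GH K; rewrite GH. Qed.

Lemma veq_trans G H K : veq G H -> veq H K -> veq G K.
Proof. by move=> GH HK L; rewrite GH HK. Qed.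

Lemma veq_iso G H : pos_iso G H -> veq G H.
Proof. by move=> GH K; apply/v_iso/union_iso => //; apply: iso_refl. Qed.

Lemma veq_v G H : veq G H -> v G = v H.
Proof.
by move=> /(_ empty_position); rewrite -!(v_iso (union0_iso _ _)).
Qed.

Lemma veq_unionr G H K : veq G H -> veq (union K G) (union K H).
Proof. by move=> GH L; rewrite !(v_iso (unionA_iso _ _ _)) GH. Qed.

Lemma veq_unionC G H : veq (union G H) (union H G).
Proof. exact/veq_iso/unionC_iso. Qed.

Lemma veq_unionl G H K : veq G H -> veq (union G K) (union H K).
Proof.
move=> GH; apply: veq_trans (veq_unionC _ _) _.
by apply: veq_trans (veq_unionC _ _); apply: veq_unionr.
Qed.

Lemma undrawn_draw_inl (G H : position) (m : line G) :
  undrawn (draw (G := union G H) (inl m)) = undrawn (union (draw m) H).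
Proof.
apply/setP=> -[e|e]; rewrite /= in_setD1 ?mem_inl ?mem_inr ?in_setD1 //.
Qed.

Lemma undrawn_draw_inr (G H : position) (m : line H) :
  undrawn (draw (G := union G H) (inr m)) = undrawn (union G (draw m)).
Proof.
apply/setP=> -[e|e]; rewrite /= in_setD1 ?mem_inl ?mem_inr ?in_setD1 //.
Qed.

Lemma draw_inl (G H : position) (m : line G) :
  draw (G := union G H) (inl m) = union (draw m) H.
Proof. by rewrite /draw; congr Position; apply: undrawn_draw_inl. Qed.

Lemma draw_inr (G H : position) (m : line H) :
  draw (G := union G H) (inr m) = union G (draw m).
Proof. by rewrite /draw; congr Position; apply: undrawn_draw_inr. Qed.

Lemma unclaimed_union (G H : position) :
  unclaimed (union G H) = inl @: unclaimed G :|: inr @: unclaimed H.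
Proof.
apply/setP=> -[b|b]; rewrite ?mem_inl ?mem_inr; apply/bigcupP/bigcupP.
- case=> -[m|m]; rewrite ?undrawn_inl ?undrawn_inr /= => mu /imsetP[c cm] // [->].
  by exists m.
- by case=> m mu bm; exists (inl m); rewrite ?undrawn_inl ?imset_f.
- case=> -[m|m]; rewrite ?undrawn_inl ?undrawn_inr /= => mu /imsetP[c cm] // [->].
  by exists m.
- by case=> m mu bm; exists (inr m); rewrite ?undrawn_inr ?imset_f.
Qed.

Lemma claims_inl (G H : position) (m : line G) :
  claims (G := union G H) (inl m) = claims m.
Proof.
have du : unclaimed (draw (G := union G H) (inl m))
    = inl @: unclaimed (draw m) :|: inr @: unclaimed H.
  by rewrite -(unclaimed_union (draw m) H) /unclaimed undrawn_draw_inl.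
rewrite /claims du unclaimed_union -(card_imset _ (@inl_inj (box G) (box H))).
apply: eq_card=> -[b|b]; rewrite in_setD ?mem_inl ?mem_inr.
  by rewrite mem_imset ?in_setD //; apply: inl_inj.
by rewrite andNb; apply/esym/imsetP=> -[].
Qed.

Lemma claims_inr (G H : position) (m : line H) :
  claims (G := union G H) (inr m) = claims m.
Proof.
have du : unclaimed (draw (G := union G H) (inr m))
    = inl @: unclaimed G :|: inr @: unclaimed (draw m).
  by rewrite -(unclaimed_union G (draw m)) /unclaimed undrawn_draw_inr.
rewrite /claims du unclaimed_union -(card_imset _ (@inr_inj (box G) (box H))).
apply: eq_card=> -[b|b]; rewrite in_setD ?mem_inl ?mem_inr.
  by rewrite andNb; apply/esym/imsetP=> -[].
by rewrite mem_imset ?in_setD //; apply: inr_inj.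
Qed.

(** * Rows of lines, chains and loops *)

(* Box [j] is to the left of line [j]. If [~~ a] (resp. [~~ b]), box [0] (resp.
   box [k]) borders no line: it is a phantom, never counted as unclaimed. *)
Definition run (a b : bool) (k : nat) : position :=
  @Position 'I_k.+1 'I_k
    (fun i => [set j : 'I_k.+1 | (j == i :> nat) && ((0 < i)%N || a)
                 || (j == i.+1 :> nat) && ((i.+1 < k)%N || b)]) setT.

Lemma run_rev_iso a b k : pos_iso (run a b k) (run b a k).
Proof.
exists (@rev_ord k), (@rev_ord k.+1); split; try exact: rev_ord_inj.
  apply/setP=> i; rewrite [RHS]in_setT -[i]rev_ordK mem_imset ?in_setT //.
  exact: rev_ord_inj.
move=> m _; apply/setP=> j; rewrite -[j]rev_ordK mem_imset; last exact: rev_ord_inj.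
rewrite !inE /=; have := ltn_ord m; have := ltn_ord (rev_ord j).
move: (rev_ord j) (nat_of_ord m) => i n; lia.
Qed.

(** The two boxes beside the drawn line become the capturable inner ends of the two remaining rows.
    The maps start from these rows because the drawn line stays in the ambient type, so that no
    injection goes the other way. *)
Lemma run_draw_iso a b i j (m : 'I_(i + j).+1) : m = i :> nat ->
  pos_iso (union (run a true i) (run true b j))
          (draw (G := run a b (i + j).+1) m).
Proof.
move=> mi.
pose f (e : 'I_i + 'I_j) : 'I_(i + j).+1 :=
  match e with inl x => inord x | inr x => inord (i.+1 + x) end.
pose g (e : 'I_i.+1 + 'I_j.+1) : 'I_(i + j).+2 :=
  match e with inl x => inord x | inr x => inord (i.+1 + x) end.
have fl x : f (inl x) = x :> nat.
  by rewrite inordK //; have := ltn_ord x; lia.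
have fr x : f (inr x) = (i.+1 + x)%N :> nat.
  by rewrite inordK //; have := ltn_ord x; lia.
have gl x : g (inl x) = x :> nat.
  by rewrite inordK //; have := ltn_ord x; lia.
have gr x : g (inr x) = (i.+1 + x)%N :> nat.
  by rewrite inordK //; have := ltn_ord x; lia.
have fI : injective f.
  move=> [x|x] [y|y] /(congr1 (@nat_of_ord _)); rewrite ?fl ?fr => E;
    have := ltn_ord x; have := ltn_ord y;
    first [lia | by move=> _ _; congr inl; apply: ord_inj; lia
               | by move=> _ _; congr inr; apply: ord_inj; lia].
have gI : injective g.
  move=> [x|x] [y|y] /(congr1 (@nat_of_ord _)); rewrite ?gl ?gr => E;
    have := ltn_ord x; have := ltn_ord y;
    first [lia | by move=> _ _; congr inl; apply: ord_inj; lia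
               | by move=> _ _; congr inr; apply: ord_inj; lia].
exists f, g; split=> //.
  apply/setP=> e; rewrite [RHS]in_setD1 in_setT andbT; apply/imsetP/idP.
    case=> -[x|x] _ ->; rewrite -val_eqE /= ?fl ?fr mi; have := ltn_ord x; lia.
  rewrite -val_eqE /= mi => ne; have [lt_ei|le_ie] := ltnP e i.
    exists (inl (Ordinal lt_ei)); first by rewrite /= mem_inl in_setT.
    by apply: ord_inj; rewrite fl.
  have lt : (e - i.+1 < j)%N by have := ltn_ord e; lia.
  exists (inr (Ordinal lt)); first by rewrite /= mem_inr in_setT.
  by apply: ord_inj; rewrite fr /=; lia.
move=> e _; apply/setP=> c; rewrite [LHS]inE; apply/idP/imsetP.
  case: e => e; rewrite ?fl ?fr; have := ltn_ord e => lte ce.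
    have ltc : (c < i.+1)%N by lia.
    exists (inl (Ordinal ltc)); last by apply: ord_inj; rewrite gl.
    rewrite mem_imset; last exact: inl_inj.
    by rewrite inE /=; lia.
  have ltc : (c - i.+1 < j.+1)%N by have := ltn_ord c; lia.
  exists (inr (Ordinal ltc)); last by apply: ord_inj; rewrite gr /=; lia.
  rewrite mem_imset; last exact: inr_inj.
  by rewrite inE /=; lia.
case=> -[d|d]; case: e => e /= /imsetP[d' + // [->]] ->;
  rewrite ?fl ?fr ?gl ?gr inE;
  have := ltn_ord e; have := ltn_ord d'; lia.
Qed.

Lemma chain_iso n : pos_iso (chain n) (run false false n.+1).
Proof.
(* Boxes shift by one because box [0] of the row, like its last box, is a phantom. *)
pose g (j : 'I_n) : 'I_n.+2 := lift ord0 (widen_ord (leqnSn n) j).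
have gE j : g j = j.+1 :> nat by [].
exists id, g; split=> //; first by move=> j k /(congr1 (@nat_of_ord _)) [/ord_inj].
  by rewrite imset_id.
move=> m _; apply/setP=> j; apply/idP/imsetP => [|[k + ->]]; last first.
  by rewrite !inE gE; have := ltn_ord k; lia.
rewrite inE => jm; have lt : (j.-1 < n)%N by have := ltn_ord m; lia.
exists (Ordinal lt); first by rewrite inE /=; lia.
by apply: ord_inj; rewrite gE /=; lia.
Qed.

Lemma loop_draw_iso n (m : 'I_n.+1) :
  pos_iso (run true true n) (draw (G := loop n.+1) m).
Proof.
(* Cut at [m], the loop is read cyclically from the successor of [m]; index [n] comes back to [m],
   which is still a box of the row but no longer a line. *)
pose g (i : nat) : 'I_n.+1 := Ordinal (ltn_pmod (m.+1 + i) (ltn0Sn n)).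
have gI i j : (i < n.+1)%N -> (j < n.+1)%N -> g i = g j -> i = j.
  move=> lti ltj /(congr1 (@nat_of_ord _)) /= /eqP.
  by rewrite eqn_modDl !modn_small // => /eqP.
have gm : g n = m.
  by apply: ord_inj; rewrite /= addSnnS modnDr modn_small.
have gS i : ordS (g i) = g i.+1.
  by apply: ord_inj; rewrite /= -addn1 modnDml addn1 addnS.
have fI : injective (fun i : 'I_n => g i).
  by move=> i j /gI E; apply: ord_inj; apply: E; apply/leqW/ltn_ord.
exists (fun i : 'I_n => g i), (fun i : 'I_n.+1 => g i); split=> //.
- by move=> i j /gI E; apply: ord_inj; apply: E.
- apply/eqP; rewrite eqEcard; apply/andP; split; last first.
    by rewrite cardsDS ?subsetT // cards1 card_imset // !cardsT !card_ord subn1.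
  apply/subsetP=> e /imsetP[i _ ->]; rewrite in_setD1 in_setT andbT.
  by apply/eqP; rewrite -[RHS]gm => /gI E; have := ltn_ord i; lia.
move=> e _; apply/setP=> c; rewrite !inE gS; apply/idP/imsetP.
  case/orP=> /eqP ->.
    by exists (widen_ord (leqnSn n) e); rewrite // inE /= eqxx orbT.
  by exists (lift ord0 e); rewrite ?lift0 // inE /= /bump /= add1n eqxx !orbT.
by case=> d; rewrite inE !orbT !andbT => /orP[] /eqP -> ->; rewrite eqxx ?orbT.
Qed.

Lemma claimsE (G : position) (m : line G) : m \in undrawn G ->
  claims m = #|[set b in borders m |
                [forall (e | e \in undrawn G :\ m), b \notin borders e]]|.
Proof.
move=> mG; congr #|pred_of_set _|; apply/setP=> b; rewrite !inE andbC.
have bE : (b \notin unclaimed (draw m))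
    = [forall (e | e \in undrawn G :\ m), b \notin borders e].
  apply/idP/forall_inP=> [bN e eG | bN].
    by apply: contra bN => be; apply/bigcupP; exists e.
  by apply/bigcupP=> -[e eG be]; have := bN e eG; rewrite be.
rewrite bE; case: forall_inP => bN; rewrite ?andbF // !andbT.
apply/bigcupP/idP=> [[e eG be] | bm]; last by exists m.
have [<- // | em] := eqVneq e m.
by have := bN e; rewrite in_setD1 em eG be => /(_ isT).
Qed.

Lemma run_claims a b i j (m : 'I_(i + j).+1) : m = i :> nat ->
  claims (G := run a b (i + j).+1) m = ((a && (i == 0%N)) + (b && (j == 0%N)))%N.
Proof.
move=> mi; rewrite claimsE ?in_setT //.
have -> : [set c in borders (p := run a b (i + j).+1) m |
    [forall (e | e \in undrawn (run a b (i + j).+1) :\ m),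
       c \notin borders (p := run a b (i + j).+1) e]]
  = [set c : 'I_(i + j).+2 | (c == i :> nat) && (a && (i == 0%N))
                || (c == i.+1 :> nat) && (b && (j == 0%N))].
  apply/setP=> c; rewrite 3!inE mi; apply/andP/idP.
    case=> cm /forall_inP H.
    have [ci|ci] := eqVneq (c : nat) i.
      have [i0|i0] := eqVneq i 0%N; first by move: cm; lia.
      have lt : (i.-1 < (i + j).+1)%N by lia.
      have := H (Ordinal lt); rewrite in_setD1 in_setT -val_eqE /= mi inE /=.
      by have := ltn_ord c; lia.
    have [j0|j0] := eqVneq j 0%N; first by move: cm; lia.
    have lt : (i.+1 < (i + j).+1)%N by lia.
    have := H (Ordinal lt); rewrite in_setD1 in_setT -val_eqE /= mi inE /=.
    by have := ltn_ord c; lia.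
  move=> cm; split; first by lia.
  apply/forall_inP=> e; rewrite in_setD1 in_setT andbT inE -val_eqE /= mi.
  by have := ltn_ord c; have := ltn_ord e; lia.
case: (a && _); case: (b && _).
- rewrite (_ : finset _ = [set inord i; inord i.+1]) ?cards2.
    by rewrite -val_eqE /= !inordK; lia.
  by apply/setP=> c; rewrite !inE -!val_eqE /= !inordK; lia.
- rewrite (_ : finset _ = [set inord i]) ?cards1 //.
  by apply/setP=> c; rewrite !inE -!val_eqE /= !inordK; lia.
- rewrite (_ : finset _ = [set inord i.+1]) ?cards1 //.
  by apply/setP=> c; rewrite !inE -!val_eqE /= !inordK; lia.
by apply/eqP; rewrite cards_eq0; apply/eqP/setP=> c; rewrite !inE; lia.
Qed.

Lemma loop_claims n (m : 'I_n) : claims (G := loop n) m = (n == 1%N).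
Proof.
rewrite claimsE ?in_setT //; case: n m => [[]//|[|n]] m.
  rewrite (_ : finset _ = [set m]) ?cards1 //.
  apply/setP=> c; rewrite !inE [c]ord1 [m]ord1 eqxx /=.
  by apply/forall_inP=> e; rewrite !inE [e]ord1 eqxx.
have ordS_neq (i : 'I_n.+2) : ordS i != i.
  rewrite -val_eqE /=; have [->|ne] := eqVneq (i : nat) n.+1.
    by rewrite modnn.
  by rewrite modn_small; have := ltn_ord i; lia.
apply/eqP; rewrite cards_eq0; apply/eqP/setP=> c; rewrite !inE.
apply/negP=> /andP[cm /forall_inP H]; case/orP: cm => /eqP cm.
  have := H (ord_pred m); rewrite in_setD1 in_setT !inE ord_predK cm eqxx orbT.
  by rewrite -{2}(ord_predK m) eq_sym ordS_neq => /(_ isT).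
by have := H (ordS m); rewrite in_setD1 in_setT !inE ordS_neq cm eqxx => /(_ isT).
Qed.

(** * Positions as lists of components *)

(* [Run a b n] is a row of [n] undrawn lines; its left (right) end line borders
   a capturable box beyond it iff [a] ([b]). An [n]-chain is
   [Run false false n.+1]. *)
Variant component := Run of bool & bool & nat | Cycle of nat.

Definition comp_pos (c : component) : position :=
  match c with Run a b n => run a b n | Cycle n => loop n end.

Definition state_pos (s : seq component) : position :=
  foldr union empty_position (map comp_pos s).

Definition V (s : seq component) : int := v (state_pos s).

(* [opt c k t]: some line of [c] claims [k] boxes and leaves [t]. *)
Definition opt (c : component) (k : nat) (t : seq component) : Prop :=
  match c with
  | Run a b n => exists i j, [/\ n = (i + j).+1, t = [:: Run a true i; Run true b j]
                   & k = ((a && (i == 0)) + (b && (j == 0)))%N]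
  | Cycle n => [/\ (0 < n)%N, t = [:: Run true true n.-1] & k = (n == 1) :> nat]
  end.

Definition mv (k : nat) (w : int) : int := if (0 < k)%N then w - k%:Z else - w.

Definition lines (s : seq component) : nat :=
  sumn [seq match c with Run _ _ n => n | Cycle n => n end | c <- s].

Lemma lines_cons c s : lines (c :: s) = (lines [:: c] + lines s)%N.
Proof. by rewrite /lines /= addn0. Qed.

Lemma lines_cat s t : lines (s ++ t) = (lines s + lines t)%N.
Proof. by rewrite /lines map_cat sumn_cat. Qed.

Lemma opt_lines c k t : opt c k t -> lines [:: c] = (lines t).+1.
Proof.
case: c => [a b n [i [j [-> -> _]]] | n [n0 -> _]]; rewrite /lines /=; lia.
Qed.

Lemma veq_cat s t : veq (state_pos (s ++ t)) (union (state_pos s) (state_pos t)).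
Proof.
elim: s => [|c s IHs] /=; first exact/veq_iso/union0_iso.
by apply: veq_trans (veq_unionr _ IHs) _; apply/veq_iso/unionA_iso.
Qed.

Lemma veq_catC s t : veq (state_pos (s ++ t)) (state_pos (t ++ s)).
Proof.
apply: veq_trans (veq_cat _ _) _; apply: veq_trans (veq_unionC _ _) _.
exact/veq_sym/veq_cat.
Qed.

Lemma veq_catl s s' t : veq (state_pos s) (state_pos s') ->
  veq (state_pos (s ++ t)) (state_pos (s' ++ t)).
Proof.
move=> ss; apply: veq_trans (veq_cat _ _) _.
by apply: veq_trans (veq_unionl _ ss) _; apply/veq_sym/veq_cat.
Qed.

Lemma veq_catr s t t' : veq (state_pos t) (state_pos t') ->
  veq (state_pos (s ++ t)) (state_pos (s ++ t')).
Proof.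
move=> tt; apply: veq_trans (veq_catC _ _) _.
by apply: veq_trans (veq_catC _ _); apply: veq_catl.
Qed.

Lemma veq_catCA s1 s2 s3 :
  veq (state_pos (s1 ++ s2 ++ s3)) (state_pos (s2 ++ s1 ++ s3)).
Proof. by rewrite !catA; apply/veq_catl/veq_catC. Qed.

Lemma V_catCA s1 s2 s3 : V (s1 ++ s2 ++ s3) = V (s2 ++ s1 ++ s3).
Proof. exact/veq_v/veq_catCA. Qed.

Lemma V_mid s1 c s2 : V (s1 ++ c :: s2) = V (c :: s1 ++ s2).
Proof. exact: (V_catCA s1 [:: c] s2). Qed.

Lemma V_swap c c' s : V (c :: c' :: s) = V (c' :: c :: s).
Proof. exact: (V_mid [:: c] c' s). Qed.

Lemma V_run0 a b s : V (Run a b 0 :: s) = V s.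
Proof.
by apply/esym/v_iso/union0_iso; apply/setP=> -[].
Qed.

Lemma V_rev a b n s : V (Run a b n :: s) = V (Run b a n :: s).
Proof. exact/v_iso/union_iso/iso_refl/run_rev_iso. Qed.

Lemma run_move a b i j (m : 'I_(i + j).+1) : m = i :> nat ->
  veq (draw (G := run a b (i + j).+1) m)
      (state_pos [:: Run a true i; Run true b j]).
Proof.
move=> mi; apply: veq_trans (veq_sym (veq_iso (run_draw_iso a b mi))) _.
apply: veq_unionr; apply: veq_trans (veq_unionC _ _).
exact: veq_iso (union0_iso _ _).
Qed.

Lemma loop_move n (m : 'I_n.+1) :
  veq (draw (G := loop n.+1) m) (state_pos [:: Run true true n]).
Proof.
apply: veq_trans (veq_sym (veq_iso (loop_draw_iso m))) _.
apply: veq_trans (veq_unionC _ _).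
exact: veq_iso (union0_iso _ _).
Qed.

Lemma comp_move (c : component) (m : line (comp_pos c)) :
  exists2 t, opt c (claims m) t & veq (draw m) (state_pos t).
Proof.
case: c m => [a b n | [|n]] m; last 2 first.
- by case: m.
- exists [:: Run true true n]; last exact: (loop_move (m : 'I_n.+1)).
  by split=> //; apply: (loop_claims (m : 'I_n.+1)).
have [i mi] : exists i, m = i :> nat by exists (m : 'I_n).
have [j nE] : exists j, n = (i + j).+1.
  by exists (n - i.+1)%N; have := ltn_ord (m : 'I_n); lia.
subst n.
exists [:: Run a true i; Run true b j]; last exact: (run_move a b mi).
by exists i, j; split=> //; apply: (run_claims a b mi).
Qed.

Lemma opt_move (c : component) k t : opt c k t ->
  exists m : line (comp_pos c),
    [/\ m \in undrawn (comp_pos c), claims m = k & veq (draw m) (state_pos t)].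
Proof.
case: c => [a b n [i [j [-> -> ->]]] | [|n] [] // _ -> ->].
  have mi : (inord i : 'I_(i + j).+1) = i :> nat by rewrite inordK; lia.
  exists (inord i); split; first by rewrite in_setT.
    exact: (run_claims a b mi).
  exact: (run_move a b mi).
exists ord0; split; first by rewrite in_setT.
  exact: (loop_claims (ord0 : 'I_n.+1)).
exact: (loop_move (ord0 : 'I_n.+1)).
Qed.

Lemma V_le c k t s : opt c k t -> V (c :: s) <= mv k (V (t ++ s)).
Proof.
move=> /opt_move[m [mc <- dm]].
suff <- : move_value (G := union (comp_pos c) (state_pos s)) (inl m)
    (v (draw (G := union (comp_pos c) (state_pos s)) (inl m))) =
    mv (claims m) (V (t ++ s)).
  rewrite {1}/V vE; apply/seqmin_le/mapP; exists (inl m) => //.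
  by rewrite mem_enum undrawn_inl.
rewrite /move_value claims_inl draw_inl; congr mv; apply: veq_v.
by apply: veq_trans (veq_unionl _ dm) _; apply/veq_sym/veq_cat.
Qed.

Lemma state_move s (m : line (state_pos s)) : m \in undrawn (state_pos s) ->
  exists s1 c s2 t, [/\ s = s1 ++ c :: s2, opt c (claims m) t
    & veq (draw m) (state_pos (t ++ s1 ++ s2))].
Proof.
elim: s m => [|c s IHs] m; first by rewrite inE.
case: m => m; rewrite ?undrawn_inl ?undrawn_inr => mu.
  have [t tc tm] := comp_move m.
  exists [::], c, s, t; rewrite claims_inl draw_inl; split=> //.
  by apply: veq_trans (veq_unionl _ tm) _; apply/veq_sym/veq_cat.
have [s1 [c' [s2 [t [sE tc tm]]]]] := IHs m mu.
exists (c :: s1), c', s2, t; rewrite claims_inr draw_inr; split=> //.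
  by rewrite {1}sE.
by apply: veq_trans (veq_unionr _ tm) _; apply: (veq_catCA [:: c]).
Qed.

(** Together with [V_le] this replaces the minimum that defines [v]. The option of [c0] provides a
    line, which excludes the default value of [seqmin]. *)
Lemma V_ex c0 k0 t0 s0 : opt c0 k0 t0 ->
  exists s1 c s2 k t, [/\ c0 :: s0 = s1 ++ c :: s2, opt c k t
    & V (c0 :: s0) = mv k (V (t ++ s1 ++ s2))].
Proof.
move=> /opt_move[m0 [m0c _ _]]; rewrite /V vE; set l := [seq _ | _ <- _].
have : seqmin l \in l.
  apply: seqmin_mem; apply/negP=> /eqP/(congr1 size); rewrite size_map -cardE.
  move/eqP; rewrite cards_eq0 => /eqP/setP/(_ (inl m0)).
  by rewrite undrawn_inl m0c inE.
case/mapP=> m; rewrite mem_enum => /state_move[s1 [c [s2 [t [sE tc tm]]]]] ->.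
exists s1, c, s2, (claims m), t; split=> //.
by rewrite /move_value (veq_v tm).
Qed.

Lemma V_nil : V [::] = 0.
Proof. by rewrite /V vE enum_set0. Qed.

(** * The value of an endgame by opening a component *)

Lemma V_le_run a b i j s :
  V (Run a b (i + j).+1 :: s)
  <= mv ((a && (i == 0%N)) + (b && (j == 0%N))) (V [:: Run a true i, Run true b j & s]).
Proof. by apply: (@V_le _ _ [:: _; _]); exists i, j. Qed.

Lemma cons_mid (c : component) s s1 c' s2 : c :: s = s1 ++ c' :: s2 ->
  [/\ s1 = [::], c' = c & s2 = s]
  \/ exists2 s1', s1 = c :: s1' & s = s1' ++ c' :: s2.
Proof.
case: s1 => [|c1 s1] /= [<- ->]; first by left.
by right; exists s1.
Qed.

Lemma V_move_le s1 c s2 k t : opt c k t ->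
  V (s1 ++ c :: s2) <= mv k (V (t ++ s1 ++ s2)).
Proof. by move=> /V_le; rewrite V_mid. Qed.

(* Boxes that can be captured without giving up control: by induction, the capture
   may be moved before any other move. *)
Lemma V_free c (x : int) : 0 <= x -> (exists k t, opt c k t) ->
  (forall s, V (c :: s) <= V s - x) ->
  (forall s k t, opt c k t -> V s - x <= mv k (V (t ++ s))) ->
  forall s, V (c :: s) = V s - x.
Proof.
move=> x0 [k0 [t0 c0]] cle cge s.
have [n] := ubnP (lines s); elim: n s => // n IHn s; rewrite ltnS => sn.
apply/le_anti; rewrite cle /=.
have [s1 [c' [s2 [k [t [/cons_mid[[-> -> ->] | [s1' -> sE]] ct ->]]]]]] := V_ex s c0.
  exact: cge.
have /IHn IH : (lines (t ++ s1' ++ s2) < n)%N.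
  apply: leq_trans sn; rewrite sE !lines_cat lines_cons (opt_lines ct); lia.
rewrite /= V_mid IH sE.
(* A move outside [c] that claims boxes keeps the term [- x]; one that claims none turns it into
   [+ x], which is no smaller as [0 <= x]. *)
by have := V_move_le s1' s2 ct; rewrite /mv; case: ifP => _; lia.
Qed.

(** * Rows with capturable ends *)

Lemma V_run1 a b s : a || b -> V (Run a b 1 :: s) = V s - (a + b)%N%:Z.
Proof.
move=> ab; apply: V_free => {s}.
- by [].
- by exists (a + b)%N, [:: Run a true 0; Run true b 0], 0%N, 0%N; rewrite !andbT.
- move=> s; have := V_le_run a b 0 0 s; rewrite !andbT !V_run0 /mv.
  by case: a b ab => [] [].
move=> s k t [i [j [ij -> ->]]]; have [-> ->] : i = 0%N /\ j = 0%N by lia.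
by rewrite /= !V_run0 /mv !andbT; case: a b ab => [] [].
Qed.

(** Either line captures an end box and leaves one line between two capturable boxes, so three boxes
    are won without losing the turn. *)
Lemma V_run2 s : V (Run true true 2 :: s) = V s - 3.
Proof.
apply: V_free => // {s}.
- by exists 1%N, [:: Run true true 0; Run true true 1], 0%N, 1%N.
- move=> s; have := V_le_run true true 0 1 s : V (Run _ _ 2 :: s) <= _.
  by rewrite V_run0 V_run1 //= /mv /=; lia.
move=> s k t [i [j [ij -> ->]]].
have [[-> ->] | [-> ->]] : (i = 0 /\ j = 1)%N \/ (i = 1 /\ j = 0)%N by lia.
  by rewrite /= V_run0 V_run1 //= /mv /=; lia.
by rewrite /= V_swap V_run0 V_run1 //= /mv /=; lia.
Qed.

Lemma V_capture a n s : V (Run a true n.+2 :: s) <= V (Run a true n.+1 :: s) - 1.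
Proof.
have := V_le_run a true n.+1 0 s.
by rewrite addn0 andbF V_swap V_run0.
Qed.

(** Capturing from the right end wins all [n + a] boxes. The guard excludes [Run true true 0], where
    no box is left to claim. *)
Lemma V_take_all a n s : (a ==> (0 < n)%N) ->
  V (Run a true n :: s) <= V s - (n + a)%N%:Z.
Proof.
case: n => [|n _]; first by case: a => // _; rewrite V_run0 subr0.
elim: n => [|n IHn]; first by rewrite V_run1 ?orbT //; case: a.
by have := V_capture a n s; lia.
Qed.

(* [2 + 2 a] boxes, i.e. two (four) of an opened chain (loop), are declined to
   keep control. *)
Lemma V_control a k s :
  V (Run a true (a + k.+2) :: s)
  <= - k%:Z - `|V s - (2 + 2 * a)%N%:Z|.
Proof.
elim: k => [|k IHk]; last first.
  by have := V_capture a (a + k.+1) s; rewrite -!addnS; lia.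
(* With [a + 2] lines left, drawing line [a] claims nothing and offers the opponent 2 boxes on one
   line, or 4 boxes on two lines. The bound is the smaller of this value and that of taking
   everything. *)
have := V_le_run a true a 1 s; have := @V_take_all a (a + 2) s.
have -> : (a + 1).+1 = (a + 2)%N by lia.
case: a => /= /(_ isT); first by rewrite !V_run1 // /mv /=; lia.
by rewrite V_run0 !V_run1 // /mv /=; lia.
Qed.

(** Here [n] counts lines: chains have at least 3 boxes, loops at least 4. *)
Definition unopened (c : component) : bool :=
  match c with
  | Run a b n => [&& ~~ a, ~~ b & 3 < n]%N
  | Cycle n => (3 < n)%N
  end.

Lemma closed_opt c k t : unopened c -> opt c k t -> k = 0%N.
Proof.
case: c => [[] [] n|n] //= n3; first by case=> i [j [_ _ ->]].
by case=> _ _ ->; lia.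
Qed.

(** Captures at an end are covered by the premise. A move inside the row lets the opponent take all
    its boxes, at least as many as the [2 + 2 * a] declined ones. A move in [s] claims nothing and,
    by [V_control], leaves a position of value at most 0; negated this is at least 0, whereas [x] is
    at most 0. *)
Lemma V_control_closed_step (a : bool) k s (x := - k%:Z - `|V s - (2 + 2 * a)%N%:Z|) :
  all unopened s ->
  x <= V (Run a true (a + k.+1) :: s) - 1 -> x <= V (Run a true (a + k.+2) :: s).
Proof.
move=> cs capt.
have op : opt (Run a true (a + k.+2)) 1 [:: Run a true (a + k.+1); Run true true 0].
  by exists (a + k.+1)%N, 0%N; rewrite addn0 !addnS andbF.
have [s1 [c [s2 [m [t [/cons_mid[[-> -> ->] | [s1' -> sE]] ct ->]]]]]] := V_ex s op.
  case: ct => i [j [ij -> ->]] /=.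
  have [j0|j0] := eqVneq j 0%N.
    subst j; have -> : i = (a + k.+1)%N by lia.
    rewrite V_swap V_run0 addnS /= andbF /mv /=; move: capt; rewrite addnS; lia.
  rewrite addn0; have [/andP[aT /eqP i0]|ai] := boolP (a && (i == 0%N)).
    subst i; have -> : j = (a + k.+1)%N by lia.
    by rewrite V_run0 aT /mv /=; move: capt; rewrite aT.
  rewrite /mv /=; have ai' : a ==> (0 < i)%N by case: (a) ai; lia.
  have := V_take_all (Run true true j :: s) ai'.
  have := @V_take_all true j s; rewrite /= lt0n j0 => /(_ isT).
  by rewrite /x; lia.
have -> : m = 0%N by apply: closed_opt ct; move: cs; rewrite sE all_cat /= => /and3P[].
have := V_control a k (t ++ s1' ++ s2).
by rewrite /mv /= V_mid /x; lia.
Qed.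

Lemma V_control_closed (a : bool) k s : all unopened s ->
  V (Run a true (a + k.+2) :: s) = - k%:Z - `|V s - (2 + 2 * a)%N%:Z|.
Proof.
move=> cs; apply/le_anti; rewrite V_control /=.
elim: k => [|k IHk]; apply: V_control_closed_step => //; last by lia.
(* After one capture the remaining [a + 1] lines yield [1 + 2 * a] free boxes, so capturing amounts
   to taking everything. *)
by case: a => /=; rewrite ?V_run2 ?V_run1 //; lia.
Qed.

(** A row of [n] lines is an [(n - 1)]-chain, whence the offset 3 in place of 2. *)
Definition open_value (c : component) (w : int) : int :=
  match c with
  | Run _ _ n => n%:Z - 3 + `|w - 2|
  | Cycle n => n%:Z - 4 + `|w - 4|
  end.

(** A chain is opened at an end line. The bound requires that the opponent has no reply better than
    control or taking all, which is known when the rest is unopened. *)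
Lemma V_open_le c s : unopened c -> all unopened s ->
  V (c :: s) <= open_value c (V s).
Proof.
case: c => [[] [] [|[|[|[|n]]]]|[|[|[|[|n]]]]] //= _ cs.
  have := V_le_run false false n.+3 0 s.
  rewrite addn0 V_swap V_run0.
  by have := V_control_closed false n.+1 cs; rewrite !add0n /mv /=; lia.
have := @V_le (Cycle n.+4) 0 [:: Run true true n.+3] s (And3 isT erefl erefl).
by have := V_control_closed true n cs; rewrite !add1n /mv /=; lia.
Qed.

Lemma open_value_le c k t s : unopened c -> opt c k t ->
  open_value c (V s) <= mv k (V (t ++ s)).
Proof.
case: c => [[] [] n|[|[|[|[|n]]]]] //=; last first.
  move=> _ [_ -> ->]; have := V_control true n s.
  by rewrite !add1n /mv /=; lia.
(* Opening a chain in the middle does not help: the opponent takes one part entirely and then plays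
   for control on the other, chosen with at least 2 lines. *)
have two_ends x y : (1 < x)%N -> V [:: Run false true x, Run false true y & s]
    <= - (x + y)%N%:Z + 2 - `|V s - 2|.
  case: x => [|[|x]] // _; rewrite V_swap.
  have := @V_take_all false y (Run false true x.+2 :: s) isT.
  by have := V_control false x s; rewrite !add0n; lia.
move=> n3 [i [j [nE -> ->]]]; rewrite /mv /= V_swap V_rev V_swap.
have [i1|i1] := ltnP 1 i; first by have := two_ends i j i1; lia.
by have := two_ends j i; rewrite V_swap; lia.
Qed.

Lemma V_open_ex s : all unopened s -> s <> [::] ->
  exists s1 c s2, s = s1 ++ c :: s2 /\ V s = open_value c (V (s1 ++ s2)).
Proof.
case: s => // c0 s0 cs _.
have [k0 [t0 op0]] : exists k t, opt c0 k t.
  case: c0 cs => [a b [|n]|[|n]] /=; rewrite ?andbF // => _; do 2!eexists.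
    by exists 0%N, n.
  by split.
have [s1 [c [s2 [k [t [sE ct VE]]]]]] := V_ex s0 op0.
exists s1, c, s2; split=> //; apply/le_anti/andP.
have [c1 [cc c2]] : all unopened s1 /\ unopened c /\ all unopened s2.
  by move: cs; rewrite sE all_cat /= => /and3P[].
split; last by rewrite VE open_value_le.
by rewrite sE V_mid V_open_le ?all_cat ?c1.
Qed.

(** * Endgames made of loops and at most one 3-chain *)

(** Open the component that is best in the presence of the [q]-loop. The loop itself changes the
    value by [p - q]; for any other component induction applies, since [open_value c] is 1-Lipschitz
    in the value of the rest. Its absolute value calls for the induction hypothesis in both
    directions. *)
Lemma V_lipschitz s p q : all unopened s -> (3 < p)%N -> (3 < q)%N ->
  V (Cycle p :: s) <= V (Cycle q :: s) + `|p%:Z - q%:Z|.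
Proof.
have [n] := ubnP (size s); elim: n s p q => // n IHn s p q; rewrite ltnS => sn cs p3 q3.
have [] := @V_open_ex (Cycle q :: s); rewrite /= ?q3 //.
move=> s1 [c [s2 [/cons_mid[[-> -> ->] | [s1' -> sE]] ->]]].
  by have := @V_open_le (Cycle p) s p3 cs; rewrite /=; lia.
move: cs; rewrite sE all_cat /= => /and3P[c1 cc c2].
have c12 : all unopened (s1' ++ s2) by rewrite all_cat c1.
have sz : (size (s1' ++ s2) < n)%N.
  by apply: leq_trans sn; rewrite sE !size_cat /= addnS.
have le_pq := IHn _ p q sz c12 p3 q3; have le_qp := IHn _ q p sz c12 q3 p3.
have := @V_open_le c (Cycle p :: s1' ++ s2) cc.
rewrite /= p3 => /(_ c12); rewrite -(V_mid (Cycle p :: s1')) /=.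
by case: c {cc sE} => [a b m|m] /=; lia.
Qed.

(* Opening a loop is never better than opening a shorter one. *)
Lemma V_shortest_loop p s : (3 < p)%N -> all unopened s ->
  all (fun c => if c is Cycle q then p <= q else true)%N s ->
  V (Cycle p :: s) = p%:Z - 4 + `|V s - 4|
  \/ exists s1 a b n s2, s = s1 ++ Run a b n :: s2 /\
       V (Cycle p :: s) = n%:Z - 3 + `|V (Cycle p :: s1 ++ s2) - 2|.
Proof.
move=> p3 cs ps; have [] := @V_open_ex (Cycle p :: s); rewrite /= ?p3 //.
move=> s1 [c [s2 [/cons_mid[[-> -> ->] | [s1' -> sE]] VE]]]; first by left.
case: c sE VE => [a b n|q] sE VE; first by right; exists s1', a, b, n, s2.
left; move: cs ps; rewrite sE !all_cat /= => /and3P[c1 q3 c2] /and3P[_ pq _].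
have c12 : all unopened (s1' ++ s2) by rewrite all_cat c1.
apply/le_anti/andP; split.
  by apply: (@V_open_le (Cycle p)) => //; rewrite all_cat /= c1 q3.
rewrite -sE VE /= sE V_mid.
(* Opening the [q]-loop costs [q - p] more in length, at least as much as the values of the two
   remainders differ. *)
by have := V_lipschitz c12 q3 p3; have := V_lipschitz c12 p3 q3; lia.
Qed.

Definition loops_value (ls : seq nat) : int := V (map Cycle ls).

(* [Run false false 4] is the 3-chain. *)
Definition three_value (ls : seq nat) : int :=
  V (Run false false 4 :: map Cycle ls).

Lemma unopened_loops ls : all (leq 4) ls -> all unopened (map Cycle ls).
Proof. by rewrite all_map. Qed.

Lemma loops_value_nil : loops_value [::] = 0.
Proof. exact: V_nil. Qed.

Lemma three_value_nil : three_value [::] = 3.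
Proof.
have [] := @V_open_ex [:: Run false false 4] => //.
move=> s1 [c [s2 [/cons_mid[[-> -> ->] | [[] // s1' _]] VE]]].
by rewrite /three_value VE /= V_nil.
Qed.

Lemma loops_value_cons p ls : all (leq 4) (p :: ls) -> all (leq p) ls ->
  loops_value (p :: ls) = p%:Z - 4 + `|loops_value ls - 4|.
Proof.
move=> /andP[p4 ls4] pls.
have [] := @V_shortest_loop p (map Cycle ls) p4; rewrite ?unopened_loops ?all_map //.
move=> [s1 [a [b [n [s2 [lsE _]]]]]].
have : all (fun c => if c is Cycle _ then true else false) (map Cycle ls).
  by rewrite all_map; apply/allP.
by rewrite lsE all_cat /= andbF.
Qed.

Lemma three_value_cons p ls : all (leq 4) (p :: ls) -> all (leq p) ls ->
  three_value (p :: ls) = Num.min (1 + `|loops_value (p :: ls) - 2|)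
                                  (p%:Z - 4 + `|three_value ls - 4|).
Proof.
move=> /andP[p4 ls4] pls; have cls := unopened_loops ls4.
have le1 : three_value (p :: ls) <= 1 + `|loops_value (p :: ls) - 2|.
  by apply: (@V_open_le (Run false false 4)); rewrite //= p4.
have le2 : three_value (p :: ls) <= p%:Z - 4 + `|three_value ls - 4|.
  rewrite /three_value /= V_swap.
  exact: (@V_open_le (Cycle p) (Run false false 4 :: map Cycle ls)).
apply/le_anti; rewrite le_min le1 le2 /= ge_min.
have [] := @V_shortest_loop p (Run false false 4 :: map Cycle ls) p4;
  rewrite /= ?cls ?all_map // V_swap.
  by move=> VE; rewrite orbC /three_value /= VE lexx.
move=> [s1 [a [b [n [s2 [/cons_mid[[-> [_ _ ->] ->] | [s1' _ lsE]] VE]]]]]].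
  by rewrite /three_value /= VE lexx.
have : all (fun c => if c is Cycle _ then true else false) (map Cycle ls).
  by rewrite all_map; apply/allP.
by rewrite lsE all_cat /= andbF.
Qed.

(** * Evaluation of the recursion on sorted lists of loops *)

(** For non-empty [ls], the controlled value of the loops with the 3-chain: 5 is [3 - 4] plus the
    terminal bonus 6. *)
Definition control (ls : seq nat) : int := 5 + \sum_(n <- ls) (n%:Z - 8).

Lemma control_cons n ls : control (n :: ls) = control ls + n%:Z - 8.
Proof. by rewrite /control big_cons addrCA [LHS]addrC [LHS]addrA. Qed.

(** Induction on the increasing list adds loops in decreasing order of length. Even lengths make the
    controlled value odd, so it skips 2. The clause on the head records that 3 is reached only by
    adding a 6-loop, so any further loop is also a 6-loop and leads to (4, 3). *)
Lemma long_loops_values ls : sorted leq ls -> ls <> [::] ->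
  all (leq 6) ls -> all (fun n => ~~ odd n) ls ->
  exists2 z : int, control ls = 2 * z + 1 &
  [/\ 3 <= control ls, 5 <= control ls \/ head 0%N ls = 6%N,
      loops_value ls = control ls + 3 & three_value ls = control ls]
  \/ [/\ control ls <= 1, head 0%N ls = 6%N &
      loops_value ls = 4 /\ three_value ls = 3
      \/ loops_value ls = 2 /\ three_value ls = 1].
Proof.
elim: ls => // p ls IHls sls _ /= /andP[p6 ls6] /andP[pe lse].
have pls : all (leq p) ls by apply: order_path_min sls => ? ? ?; apply: leq_trans.
have ls4 : all (leq 4) (p :: ls).
  by apply/andP; split; [lia | apply: sub_all ls6 => n /=; lia].
rewrite loops_value_cons // three_value_cons // loops_value_cons // control_cons.
have [h pE] : exists h : nat, p = h.*2 by exists p./2; lia.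
case: ls => [|q ls] in IHls sls ls6 lse pls ls4 *.
  rewrite loops_value_nil three_value_nil /control big_nil.
  by exists (h%:Z - 2); [lia | left; split; lia].
have qN : q :: ls <> [::] by [].
have [z zE cases] := IHls (path_sorted sls) qN ls6 lse.
exists (z + h%:Z - 4); first by lia.
have pq : (p <= q)%N by case/andP: pls.
case: cases => [[c3 /= c5 -> ->] | [c1 /= q6 vals]].
  have [c3'|c1'] := lerP 3 (control (q :: ls) + p%:Z - 8); first by left; split; lia.
  by right; split; [lia | lia | left; split; lia].
have p6' : p = 6%N by lia.
by right; split; [lia | lia | rewrite p6'; case: vals => -[-> ->]; [right | left]].
Qed.

(** For [0 <= d <= 7] and even [f] this is the distance from [d] to the nearest multiple of 8;
    raising [f] by one replaces it by 4 minus itself. *)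
Definition residue_value (f : nat) (d : int) : int :=
  if odd f then `|4 - d| else 4 - `|4 - d|.

Lemma four_loops_values f t (d q : int) : sorted leq t ->
  all (leq 6) t -> all (fun n => ~~ odd n) t ->
  0 <= d <= 7 -> three_value t = d + 8 * q ->
  let ls := nseq f 4%N ++ t in
  [\/ [/\ 3 <= control ls, loops_value ls = control ls + 3,
        three_value ls = control ls & three_value t = control ls + 4 * f%:Z],
      [/\ control ls <= 1, loops_value ls = 2 & three_value ls = 1]
    | [/\ control ls <= 1 \/ ls = [::], loops_value ls = 0 \/ loops_value ls = 4,
        three_value ls = 1 \/ three_value ls = 3
        & three_value ls = residue_value f d]].
Proof.
move=> st t6 te d07 tE.
(* Oddness leaves 3 and 5 as the only values from which a 4-loop ends the first regime. *)
have [w wE] : exists w : int, three_value t = 2 * w + 1.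
  have [->|tN] := eqVneq t [::]; first by exists 1; rewrite three_value_nil.
  have [z zE [[_ _ _ ->]|[_ _ [] [_ ->]]]] := long_loops_values st (elimN eqP tN) t6 te;
    by [exists z | exists 1 | exists 0].
elim: f => [|f IHf] ls.
  have [t0|tN] := eqVneq t [::].
    (* The pair (0, 3) of the empty list already alternates although [control [::]] is 5, hence the
       disjunction in the third case. *)
    constructor 3; move: tE; rewrite /ls t0 /= loops_value_nil three_value_nil.
    by rewrite /residue_value /= => tE; split; [right | left | right | lia].
  have [z zE [[c3 _ vA vB]|[c1 _ [] [vA vB]]]] :=
    long_loops_values st (elimN eqP tN) t6 te.
  - by constructor 1; rewrite /ls /=; split; lia.
  - by constructor 3; rewrite /residue_value /ls /=; split; lia.
  - by constructor 2; rewrite /ls /=; split; lia.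
have l4 : all (leq 4) (nseq f 4%N ++ t).
  by rewrite all_cat all_nseq /= orbT; apply: sub_all t6 => n /=; lia.
have pl4 : all (leq 4) (4%N :: (nseq f 4%N ++ t)) by [].
rewrite /ls [nseq _ _]/= cat_cons control_cons (three_value_cons pl4 l4).
rewrite (loops_value_cons pl4 l4).
have rE : residue_value f.+1 d = 4 - residue_value f d.
  by rewrite /residue_value /=; case: (odd f) => /=; lia.
case: IHf => [[c3 -> -> BE]|[c1 -> ->]|[c1 A04 B13 BE]].
- have [c3'|c3'] := lerP 3 (control (nseq f 4%N ++ t) + 4%:Z - 8).
    by constructor 1; split; lia.
  move: (control _) c3 c3' BE => c c3 c3' BE.
  have [c5|c5] := eqVneq c 5.
    constructor 3; rewrite rE /residue_value.
    by split; [left; lia | right; lia | left; lia | case: ifP; lia].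
  by constructor 2; split; lia.
- by constructor 2; split; lia.
constructor 3; rewrite rE -BE; split; [left | lia | lia | lia].
by case: c1 => [|->]; rewrite ?/control ?big_nil; lia.
Qed.

(** * Reduction of endgames to sorted lists of loops *)

Lemma perm_sort_four_loops ls :
  perm_eq ls (nseq (count_mem 4%N ls) 4%N ++ sort leq [seq n <- ls | n != 4%N]).
Proof.
have <- : [seq n <- ls | n == 4%N] = nseq (count_mem 4%N ls) 4%N.
  by rewrite -size_filter; apply/all_pred1P/filter_all.
have := perm_refl ls; rewrite -(perm_filterC (pred1 4%N) ls) => perm.
rewrite perm_sym; apply: perm_trans perm; apply: perm_cat => //.
by rewrite perm_sort.
Qed.
Lemma V_perm u ls ls' : perm_eq ls ls' ->
  V (u ++ map Cycle ls) = V (u ++ map Cycle ls').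
Proof.
apply: (catCA_perm_subst (F := fun ls => V (u ++ map Cycle ls))) => s1 s2 s3.
by rewrite !map_cat; apply/veq_v/veq_catr/veq_catCA.
Qed.

Lemma veq_position_of G : veq (position_of G)
  (state_pos ([seq Run false false n.+1 | n <- chains G] ++ map Cycle (loops G))).
Proof.
case: G => cs ls; rewrite /position_of /state_pos /=.
elim: cs => [|c cs IHcs] /=.
  by elim: ls => [|l ls IHls] //=; apply: veq_unionr.
apply: veq_trans (veq_unionr _ IHcs) _; apply: veq_unionl.
exact/veq_iso/chain_iso.
Qed.

Theorem corollary24 (G H : endgame)
  (G_simple : simple_loony G)
  (G_def : G = add_endgame three_chain H)
  (H_no_chains : chains H = [::])
  (H_nonempty : loops H <> [::]) :
  let f : nat := four_loops H in
  let c : int := cv G in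
  let M : endgame := remove_four_loops G in
  [/\ 2 <= c -> v (position_of G) = c,
      c <= 1 -> v (position_of H) = 2 -> v (position_of G) = 1,
      c <= 1 -> v (position_of H) <> 2 -> f = 0%N -> v (position_of G) = 3
    & c <= 1 -> v (position_of H) <> 2 -> (1 <= f)%N ->
      forall d : int, 0 <= d <= 7 -> (d = v (position_of M) %[mod 8])%Z ->
        (odd f -> v (position_of G) = `|4 - d|) /\
        (~~ odd f -> v (position_of G) = 4 - `|4 - d|)].
Proof.
move=> f c M.
have [_ loops_simple] := G_simple.
have loopsG : loops G = loops H by rewrite G_def.
have chainsG : chains G = [:: 3%N] by rewrite G_def /= H_no_chains.
pose t := sort leq [seq n <- loops H | n != 4%N].
pose ls := nseq f 4%N ++ t.
have perm_ls : perm_eq (loops H) ls := perm_sort_four_loops _.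
have perm_t : perm_eq [seq n <- loops H | n != 4%N] t by rewrite perm_sym perm_sort.
have vG : v (position_of G) = three_value ls.
  rewrite (veq_v (veq_position_of G)) loopsG chainsG.
  exact: (V_perm [:: Run false false 4]).
have vH : v (position_of H) = loops_value ls.
  by rewrite (veq_v (veq_position_of H)) H_no_chains; apply: (V_perm [::]).
have vM : v (position_of M) = three_value t.
  rewrite (veq_v (veq_position_of M)) /= loopsG chainsG.
  exact: (V_perm [:: Run false false 4]).
have cE : c = control ls.
  rewrite /c /cv /fcv /tb loopsG chainsG /control (perm_big _ perm_ls) big_seq1.
  by case: (loops H) H_nonempty => [|n hs] //= _; rewrite addrAC.
have lsN : ls <> [::] by move=> ls0; move: perm_ls; rewrite ls0 => /perm_nilP.
have t_simple n : n \in t -> (6 <= n)%N && ~~ odd n.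
  rewrite mem_sort mem_filter -loopsG => /andP[n4 /loops_simple[le4n en]].
  by rewrite en; lia.
have t6 : all (leq 6) t by apply/allP=> n /t_simple/andP[].
have te : all (fun n => ~~ odd n) t by apply/allP=> n /t_simple/andP[].
have st : sorted leq t by apply: sort_sorted; apply: leq_total.
have values d q := four_loops_values f (d := d) (q := q) st t6 te.
rewrite vG vH vM cE.
have d_ok : 0 <= (three_value t %% 8)%Z <= 7.
  by have := modz_ge0 (three_value t) (isT : 8 != 0 :> int);
     have := ltz_pmod (three_value t) (isT : 0 < 8 :> int); lia.
have tE : three_value t = (three_value t %% 8)%Z + 8 * (three_value t %/ 8)%Z.
  by rewrite addrC mulrC -divz_eq.
have vals := values _ _ d_ok tE; rewrite -/ls /= in vals.
(* As [ls] is not empty, (a) is the first case of [vals], and (b) is the second, the only one with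
   [control ls <= 1] and loop value 2. For (c) there are no 4-loops, and the values of long loops
   leave only (4, 3). Part (d) is the third case. *)
split.
- by case: vals => [[]|[]|[[]]] //; lia.
- by case: vals => [[]|[]|[[]]] //; lia.
- move=> c1 A2 f0; have tl : ls = t by rewrite /ls f0.
  have tN : t <> [::] by rewrite -tl.
  have [z _] := long_loops_values st tN t6 te; rewrite -tl.
  by case=> [[]|[_ _ []] []] //; lia.
move=> c1 A2 f1 d d07 dE.
have dE' : d = (three_value t %% 8)%Z.
  by rewrite -dE modz_small //; lia.
rewrite dE'; move: vals; rewrite /residue_value.
by case=> [[]|[]|[_ _ _ ->]]; try lia; split=> [->|/negPf->].
Qed.
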